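(* If $\alpha\beta\gamma\neq0$ and $\alpha+\beta+\gamma+\alpha\beta\gamma\neq0$, then $A(\alpha,\beta,\gamma)$ is isomorphic to $TV/(R)$ where $R\subseteq V^{\otimes2}$ is the subspace consisting of those $(1,1)$-forms that vanish on the graph of the bijection $\theta:\mathfrak P\to\ominus\mathfrak P$.
   Context: $\Bbbk$ is a field of characteristic not $2$ containing a fixed square root $i$ of $-1$; the parameters $\alpha,\beta,\gamma\in\Bbbk$ have fixed square roots $a,b,c\in\Bbbk$ respectively. $V$ is the vector space with basis $x_0,x_1,x_2,x_3$, and $TV$ is its tensor algebra, the free algebra $\Bbbk\langle x_0,x_1,x_2,x_3\rangle$. Write $[x,y]=xy-yx$, $\{x,y\}=xy+yx$. $A(\alpha,\beta,\gamma)$ is $TV$ modulo the six relations $$[x_0,x_1]=\alpha\{x_2,x_3\},\quad [x_0,x_2]=\beta\{x_3,x_1\},\quad [x_0,x_3]=\gamma\{x_1,x_2\},$$ $$\{x_0,x_1\}=[x_2,x_3],\quad \{x_0,x_2\}=[x_3,x_1],\quad \{x_0,x_3\}=[x_1,x_2].$$ Elements of $V\otimes V$ are viewed as forms of bi-degree $(1,1)$ on $\mathbb P(V^* )\times\mathbb P(V^* )=\mathbb P^3\times\mathbb P^3$. $\mathfrak P=\mathfrak P_\infty\cup\mathfrak P_0\cup\mathfrak P_1\cup\mathfrak P_2\cup\mathfrak P_3\subseteq\mathbb P^3$ where $\mathfrak P_\infty=\{(1,0,0,0),(0,1,0,0),(0,0,1,0),(0,0,0,1)\}$, $\mathfrak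 P_0=\{(abc,a,b,c),(abc,a,-b,-c),(abc,-a,b,-c),(abc,-a,-b,c)\}$, $\mathfrak P_1=\{(a,-ia,-i,-1),(a,-ia,i,1),(a,ia,-i,1),(a,ia,i,-1)\}$, $\mathfrak P_2=\{(b,-1,-ib,-i),(b,-1,ib,i),(b,1,-ib,i),(b,1,ib,-i)\}$, $\mathfrak P_3=\{(c,-i,-1,-ic),(c,-i,1,ic),(c,i,-1,ic),(c,i,1,-ic)\}$. Define $\ominus(\xi_0,\xi_1,\xi_2,\xi_3)=(-\xi_0,\xi_1,\xi_2,\xi_3)$ on $\mathbb P^3$, and $\gamma_1(\xi_0,\xi_1,\xi_2,\xi_3)=(\xi_0,\xi_1,-\xi_2,-\xi_3)$, $\gamma_2(\xi_0,\xi_1,\xi_2,\xi_3)=(\xi_0,-\xi_1,\xi_2,-\xi_3)$, $\gamma_3(\xi_0,\xi_1,\xi_2,\xi_3)=(\xi_0,-\xi_1,-\xi_2,\xi_3)$. The map $\theta:\mathfrak P\to\ominus\mathfrak P$ is $\theta(p)=p$ if $p\in\mathfrak P_\infty$, $\theta(p)=\ominus p$ if $p\in\mathfrak P_0$, and $\theta(p)=\ominus\gamma_j(p)$ if $p\in\mathfrak P_j$, $j=1,2,3$. *)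

(* Defs.v *)
From HB Require Import structures.
From mathcomp Require Import all_boot all_order all_algebra.
From mathcomp Require Import boolp monalg.
From mathcomp Require Import generic_quotient ring_quotient.

Set Implicit Arguments.
Unset Strict Implicit.
Unset Printing Implicit Defensive.

Import GRing.Theory.
Local Open Scope ring_scope.
Local Open Scope quotient_scope.

Section TwoSidedIdeal.
Variables (A : nzRingType) (S : A -> Prop).

Inductive ideal_gen : A -> Prop :=
| ideal_gen_incl x : S x -> ideal_gen x
| ideal_gen0 : ideal_gen 0
| ideal_genD x y : ideal_gen x -> ideal_gen y -> ideal_gen (x + y)
| ideal_genMl z x : ideal_gen x -> ideal_gen (z * x)
| ideal_genMr z x : ideal_gen x -> ideal_gen (x * z).

Definition ideal_mem : {pred A} := fun x => `[< ideal_gen x >].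

Lemma ideal_memP x : reflect (ideal_gen x) (x \in ideal_mem).
Proof. exact: asboolP. Qed.

Lemma ideal_mem_zmod_closed : zmod_closed ideal_mem.
Proof.
split; first by apply/ideal_memP; exact: ideal_gen0.
move=> x y /ideal_memP Ix /ideal_memP Iy; apply/ideal_memP.
by apply: ideal_genD => //; rewrite -mulN1r; exact: ideal_genMl.
Qed.

HB.instance Definition _ :=
  GRing.isZmodClosed.Build A ideal_mem ideal_mem_zmod_closed.

Lemma ideal_memMl z x : x \in ideal_mem -> z * x \in ideal_mem.
Proof. by move=> /ideal_memP Ix; apply/ideal_memP; exact: ideal_genMl. Qed.

Lemma ideal_memMr z x : x \in ideal_mem -> x * z \in ideal_mem.
Proof. by move=> /ideal_memP Ix; apply/ideal_memP; exact: ideal_genMr. Qed.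

End TwoSidedIdeal.

(* The quotient A/(S) by the two-sided ideal generated by S. As S is
   arbitrary the quotient may be trivial, hence it is a pzRingType; together
   with its lmodType structure, this is what makes it a k-algebra (algType
   would require 1 != 0). *)
Definition quot_alg (k : fieldType) (A : lalgType k) (S : A -> Prop) : Type :=
  Quotient.quot (ideal_mem S).

Section QuotientAlgebra.
Variables (k : fieldType) (A : lalgType k) (S : A -> Prop).
Local Notation Q := (quot_alg S).
Local Notation I := (ideal_mem S).

HB.instance Definition _ := EqQuotient.copy Q (Quotient.quot I).
HB.instance Definition _ := GRing.Zmodule.copy Q (Quotient.quot I).

Let eq_piE x y : (\pi_Q x == \pi_Q y) = (x - y \in I).
Proof. by rewrite Quotient.idealrBE. Qed.

Definition quot_one : Q := lift_cst Q 1.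
Definition quot_mul := lift_op2 Q *%R.
Definition quot_scale (c : k) := lift_op1 Q ( *:%R c).

Let repr_pi x : repr (\pi_Q x) - x \in I.
Proof. by rewrite -eq_piE reprK. Qed.

Lemma pi_quot_mul x y : quot_mul (\pi_Q x) (\pi_Q y) = \pi_Q (x * y).
Proof.
unlock quot_mul; apply/eqP; rewrite eq_piE.
rewrite -[X in X - _](subrK (repr (\pi_Q x) * y)) -mulrBr -addrA -mulrBl.
by apply: rpredD; [apply: ideal_memMl | apply: ideal_memMr]; exact: repr_pi.
Qed.

Lemma pi_quot_scale c x : quot_scale c (\pi_Q x) = \pi_Q (c *: x).
Proof.
by unlock quot_scale; apply/eqP; rewrite eq_piE -scalerBr -mulr_algl ideal_memMl ?repr_pi.
Qed.

Lemma pi_quotD x y : \pi_Q (x + y) = \pi_Q x + \pi_Q y :> Q.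
Proof. exact: (Quotient.pi_add I). Qed.

Lemma quot_mulA : associative quot_mul.
Proof.
elim/quotW=> x; elim/quotW=> y; elim/quotW=> z.
by rewrite !pi_quot_mul mulrA.
Qed.

Lemma quot_mul1 : left_id quot_one quot_mul.
Proof. by elim/quotW=> x; unlock quot_one; rewrite pi_quot_mul mul1r. Qed.

Lemma quot_mulr1 : right_id quot_one quot_mul.
Proof. by elim/quotW=> x; unlock quot_one; rewrite pi_quot_mul mulr1. Qed.

Lemma quot_mulDl : left_distributive quot_mul +%R.
Proof.
elim/quotW=> x; elim/quotW=> y; elim/quotW=> z.
by rewrite -pi_quotD !pi_quot_mul mulrDl pi_quotD.
Qed.

Lemma quot_mulDr : right_distributive quot_mul +%R.
Proof.
elim/quotW=> x; elim/quotW=> y; elim/quotW=> z.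
by rewrite -pi_quotD !pi_quot_mul mulrDr pi_quotD.
Qed.

HB.instance Definition _ := GRing.Zmodule_isPzRing.Build Q
  quot_mulA quot_mul1 quot_mulr1 quot_mulDl quot_mulDr.

Lemma quot_scaleA c d x : quot_scale c (quot_scale d x) = quot_scale (c * d) x.
Proof. by elim/quotW: x => x; rewrite !pi_quot_scale scalerA. Qed.

Lemma quot_scale1 : left_id 1 quot_scale.
Proof. by elim/quotW=> x; rewrite pi_quot_scale scale1r. Qed.

Lemma quot_scaleDr : right_distributive quot_scale +%R.
Proof.
move=> c; elim/quotW=> x; elim/quotW=> y.
by rewrite -pi_quotD !pi_quot_scale scalerDr pi_quotD.
Qed.

Lemma quot_scaleDl x : {morph quot_scale^~ x : c d / c + d}.
Proof.
by elim/quotW: x => x c d; rewrite !pi_quot_scale scalerDl pi_quotD.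
Qed.

HB.instance Definition _ := GRing.Zmodule_isLmodule.Build k Q
  quot_scaleA quot_scale1 quot_scaleDr quot_scaleDl.

End QuotientAlgebra.

Section Algebra.
Variable k : fieldType.

(* V has basis x_0, ..., x_3; TV is the free algebra k<x_0, ..., x_3>, i.e.
   the monoid algebra of the free monoid on four letters. *)
Definition TV := {malg k[{fmonom 'I_4}]}.
HB.instance Definition _ := GRing.Lalgebra.on TV.

Definition gen (j : 'I_4) : TV := mkmalgU (fmu j) 1.

Local Notation x0 := (gen (inord 0)).
Local Notation x1 := (gen (inord 1)).
Local Notation x2 := (gen (inord 2)).
Local Notation x3 := (gen (inord 3)).

Definition commutator (f g : TV) : TV := f * g - g * f.
Definition anticommutator (f g : TV) : TV := f * g + g * f.

Definition relA (alpha beta gamma : k) (f : TV) : Prop :=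
  f \in [:: commutator x0 x1 - alpha *: anticommutator x2 x3;
            commutator x0 x2 - beta  *: anticommutator x3 x1;
            commutator x0 x3 - gamma *: anticommutator x1 x2;
            anticommutator x0 x1 - commutator x2 x3;
            anticommutator x0 x2 - commutator x3 x1;
            anticommutator x0 x3 - commutator x1 x2].

Definition algA (alpha beta gamma : k) := quot_alg (relA alpha beta gamma).

(* An element of V (x) V is given by its matrix of coefficients on the
   basis x_s (x) x_t. *)
Definition tensor2 (M : 'M[k]_4) : TV := \sum_s \sum_t M s t *: (gen s * gen t).

End Algebra.

Section Geometry.
Variable k : fieldType.

(* Points of P^3 = P(V^* ) are lines in V^* = k^4, where the s-th coordinate
   of a vector is the value of x_s on it. *)
Record P3 := Point { line : {vspace 'rV[k]_4}; _ : \dim line == 1 }.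
HB.instance Definition _ := [isSub for line].
HB.instance Definition _ := [Equality of P3 by <:].

Definition vec4 (v0 v1 v2 v3 : k) : 'rV[k]_4 :=
  \row_j [:: v0; v1; v2; v3]`_j.

(* The set of points having one of the given vectors as homogeneous
   coordinates. *)
Definition points (s : seq 'rV[k]_4) : pred P3 :=
  [pred p | line p \in [seq <[v]>%VS | v <- s]].

Definition form_vanishes (M : 'M[k]_4) (p q : P3) : Prop :=
  forall u v : 'rV[k]_4, u \in line p -> v \in line q -> u *m M *m v^T = 0.

(* Change of sign of the coordinates with index in s, on k^4 and on P^3. *)
Definition flipv (s : seq nat) (v : 'rV[k]_4) : 'rV[k]_4 :=
  \row_j (if (j : nat) \in s then - v 0 j else v 0 j).

Lemma flipv_is_linear s : linear (flipv s).
Proof.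
move=> c u v; apply/rowP => j; rewrite !mxE.
by case: ifP => _ //; rewrite opprD mulrN.
Qed.

HB.instance Definition _ s :=
  GRing.isLinear.Build k 'rV[k]_4 'rV[k]_4 _ (flipv s) (flipv_is_linear s).

Lemma flipvK s : involutive (flipv s).
Proof.
by move=> v; apply/rowP => j; rewrite !mxE; case: (_ \in s); rewrite ?opprK.
Qed.

Lemma flip_subproof s (p : P3) : \dim (linfun (flipv s) @: line p)%VS == 1.
Proof.
case: p => U /= dimU; rewrite limg_dim_eq //.
apply/eqP; rewrite -subv0; apply/subvP => v.
rewrite memv_cap memv_ker lfunE /= => /andP[_ /eqP v0].
by rewrite -[v](flipvK s) v0 linear0 mem0v.
Qed.

Definition flip (s : seq nat) (p : P3) : P3 := Point (flip_subproof s p).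

Definition ominus : P3 -> P3 := flip [:: 0].
Definition gamma1 : P3 -> P3 := flip [:: 2; 3].
Definition gamma2 : P3 -> P3 := flip [:: 1; 3].
Definition gamma3 : P3 -> P3 := flip [:: 1; 2].

Variables i a b c : k.

Definition Pinf : pred P3 := points
  [:: vec4 1 0 0 0; vec4 0 1 0 0; vec4 0 0 1 0; vec4 0 0 0 1].

Definition P_0 : pred P3 := points
  [:: vec4 (a * b * c) a b c;        vec4 (a * b * c) a (- b) (- c);
      vec4 (a * b * c) (- a) b (- c); vec4 (a * b * c) (- a) (- b) c].

Definition P_1 : pred P3 := points
  [:: vec4 a (- (i * a)) (- i) (- 1); vec4 a (- (i * a)) i 1;
      vec4 a (i * a) (- i) 1;         vec4 a (i * a) i (- 1)].

Definition P_2 : pred P3 := points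
  [:: vec4 b (- 1) (- (i * b)) (- i); vec4 b (- 1) (i * b) i;
      vec4 b 1 (- (i * b)) i;         vec4 b 1 (i * b) (- i)].

Definition P_3 : pred P3 := points
  [:: vec4 c (- i) (- 1) (- (i * c)); vec4 c (- i) 1 (i * c);
      vec4 c i (- 1) (i * c);         vec4 c i 1 (- (i * c))].

Definition PP : pred P3 :=
  [pred p | [|| Pinf p, P_0 p, P_1 p, P_2 p | P_3 p]].

(* When a * b * c != 0 and char k is not 2, the five sets above are pairwise disjoint, so the order
   of the cases is irrelevant; the value outside PP is never used. *)
Definition theta (p : P3) : P3 :=
  if Pinf p then p
  else if P_0 p then ominus p
  else if P_1 p then ominus (gamma1 p)
  else if P_2 p then ominus (gamma2 p)
  else if P_3 p then ominus (gamma3 p)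
  else p.

(* The subspace R of V (x) V, embedded in TV. *)
Definition relR (f : TV k) : Prop :=
  exists2 M : 'M[k]_4, f = tensor2 M &
    forall p : P3, PP p -> form_vanishes M p (theta p).

Definition algR := quot_alg relR.

End Geometry.

(* Main.v *)
From HB Require Import structures.
Require Import Defs.
From mathcomp Require Import all_boot all_order all_algebra.
From mathcomp Require Import generic_quotient ring_quotient ring.
Import GRing.Theory.
Local Open Scope ring_scope.
Local Open Scope quotient_scope.

Set Implicit Arguments.
Unset Strict Implicit.
Unset Printing Implicit Defensive.

(** The six quadratic relations already span [R], so that the two algebras are
    quotients of the free algebra by the same ideal.

    Write a bilinear form as a 4 x 4 matrix [M].  For each cyclic permutation
    [(j, s, t)] of [(1, 2, 3)] there is one relation built on the commutator
    of [x_0] and [x_j] and one built on their anticommutator; both involve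
    only the four entries [M 0 j], [M j 0], [M s t], [M t s].  As 2 is
    invertible, the span of the relations is cut out by ten equations: the
    four diagonal entries vanish, and for each [j] the [comm_defect] and the
    [anti_defect] of [M] vanish ([rel_forms_no_defect], [no_defect_span]).

    On the other side, evaluate [M] on the graph of theta.  The coordinate
    points give the diagonal entries.  The other sixteen points come in four
    families of four, inside which the points differ by signs forming a Klein
    four-group.  At a point of such a family the value of [M] is a sum of
    three defects, one for each [j], multiplied by nonzero constants and by
    three distinct nontrivial characters of that group.  Orthogonality of
    characters ([klein_sums]) then shows that [M] vanishes on the four
    points exactly when these three defects vanish.  The first family yields
    the three commutator defects, and each of the other families yields one
    commutator defect and two anticommutator defects, so that together they
    yield all six ([vanishes_on_PP]).

    The hypothesis on [alpha + beta + gamma + alpha * beta * gamma] keeps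
    the families disjoint, so that theta is given on each of them by its own
    formula: inside a family the squares of the coordinates are constant, and
    proportionality of two such vectors of squares forces two of the
    parameters to be [1] and [- 1] ([disjoint_0], [disjoint_1],
    [disjoint_2]). *)

(** * Change of generators of a two-sided ideal *)

Section ChangeOfGenerators.
Variables (k : fieldType) (A : lalgType k).
Implicit Types S T : A -> Prop.

Lemma ideal_gen_mono S T :
  (forall x, S x -> ideal_gen T x) -> forall x, ideal_gen S x -> ideal_gen T x.
Proof.
move=> sST x; elim=> {x} [x /sST // | | x y _ Ix _ Iy | z x _ Ix | z x _ Ix].
- exact: ideal_gen0.
- exact: ideal_genD.
- exact: ideal_genMl.
- exact: ideal_genMr.
Qed.

Lemma pi_quot_eq S x y :
  (\pi_(quot_alg S) x == \pi_(quot_alg S) y) = (x - y \in ideal_mem S).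
Proof. by rewrite Quotient.idealrBE. Qed.

Lemma pi_quotB S x y :
  \pi_(quot_alg S) (x - y) = \pi_(quot_alg S) x - \pi_(quot_alg S) y.
Proof. by apply/eqP; rewrite eq_sym subr_eq -pi_quotD subrK. Qed.

Lemma pi_quot1 S : \pi_(quot_alg S) 1 = 1.
Proof. by rewrite -[RHS]/(quot_one S) /quot_one; unlock. Qed.

Definition quot_change S T (x : quot_alg S) : quot_alg T :=
  \pi_(quot_alg T) (repr x).

Lemma quot_change_pi S T :
  (forall x, S x -> ideal_gen T x) ->
  forall x, quot_change T (\pi_(quot_alg S) x) = \pi_(quot_alg T) x.
Proof.
move=> sST x; apply/eqP; rewrite pi_quot_eq; apply/ideal_memP.
apply: (ideal_gen_mono sST); apply/ideal_memP.
by rewrite -pi_quot_eq reprK.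
Qed.

(** When each set of generators lies in the ideal of the other, both quotients
    are the same set of classes; the isomorphism sends the class of [x] to the
    class of [x], and [quot_change] realizes it by choosing representatives. *)
Lemma quot_alg_iso S T :
  (forall x, S x -> ideal_gen T x) -> (forall x, T x -> ideal_gen S x) ->
  exists f : {rmorphism quot_alg S -> quot_alg T}, scalable f /\ bijective f.
Proof.
move=> sST sTS; pose f := @quot_change S T; pose g := @quot_change T S.
have fE : forall x, f (\pi x) = \pi x := quot_change_pi sST.
have gE : forall x, g (\pi x) = \pi x := quot_change_pi sTS.
have fB : zmod_morphism f.
  elim/quotW=> x; elim/quotW=> y.
  by rewrite -pi_quotB !fE pi_quotB.
have fM : monoid_morphism f.
  split; first by rewrite -!pi_quot1 fE.
  elim/quotW=> x; elim/quotW=> y.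
  by rewrite [_ * _]pi_quot_mul !fE [RHS]pi_quot_mul.
pose faM := GRing.isZmodMorphism.Build _ _ f fB.
pose frM := GRing.isMonoidMorphism.Build _ _ f fM.
pose F : {rmorphism quot_alg S -> quot_alg T} := HB.pack f faM frM.
exists F; split.
  move=> c; elim/quotW=> x.
  by rewrite [c *: _]pi_quot_scale /= !fE [RHS]pi_quot_scale.
by exists g; elim/quotW=> x /=; [rewrite fE gE | rewrite gE fE].
Qed.

End ChangeOfGenerators.

(** * The six relations as bilinear forms *)

Local Notation i0 := (inord 0 : 'I_4).
Local Notation i1 := (inord 1 : 'I_4).
Local Notation i2 := (inord 2 : 'I_4).
Local Notation i3 := (inord 3 : 'I_4).

(** The indices of [V] are written [inord n], so that a case analysis on an
    index has to end on terms of that shape. *)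
Lemma ord4P (P : 'I_4 -> Prop) : P i0 -> P i1 -> P i2 -> P i3 -> forall s, P s.
Proof.
move=> P0 P1 P2 P3 s; rewrite -[s]inord_val.
by case: s => [] [|[|[|[|]]]].
Qed.

Lemma sum4E (V : nmodType) (F : 'I_4 -> V) :
  \sum_s F s = F i0 + F i1 + F i2 + F i3.
Proof.
rewrite !big_ord_recl big_ord0 addr0 !addrA.
by do 3?[congr (_ + _)]; congr F; apply: val_inj; rewrite /= inordK.
Qed.

Lemma inord4E :
  ((i0 == i1) = false) * ((i0 == i2) = false) * ((i0 == i3) = false) *
  ((i1 == i0) = false) * ((i1 == i2) = false) * ((i1 == i3) = false) *
  ((i2 == i0) = false) * ((i2 == i1) = false) * ((i2 == i3) = false) *
  ((i3 == i0) = false) * ((i3 == i1) = false) * ((i3 == i2) = false).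
Proof. by do !split; rewrite -val_eqE /= !inordK. Qed.

Section RelationForms.
Variable k : fieldType.
Implicit Types (M : 'M[k]_4) (alpha beta gamma : k).

Lemma tensor2_is_linear : linear (@tensor2 k).
Proof.
move=> d M N; rewrite /tensor2 scaler_sumr -big_split /=.
apply: eq_bigr => s _; rewrite scaler_sumr -big_split /=.
by apply: eq_bigr => t _; rewrite !mxE scalerDl scalerA.
Qed.

HB.instance Definition _ :=
  GRing.isLinear.Build k 'M[k]_4 (TV k) _ (@tensor2 k) tensor2_is_linear.

(** The module is abstract because unfolding the multiplication of the free
    algebra during rewriting would be costly. *)
Lemma sum_delta (V : lmodType k) n (F : 'I_n -> 'I_n -> V) (s t : 'I_n) :
  \sum_p \sum_q (delta_mx s t : 'M[k]_n) p q *: F p q = F s t.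
Proof.
rewrite (bigD1 s) //= (bigD1 t) //= mxE !eqxx scale1r.
rewrite !big1 ?addr0 // => [p /negPf psF | q /negPf qtF].
  by rewrite big1 // => q _; rewrite mxE psF scale0r.
by rewrite mxE qtF andbF scale0r.
Qed.

Lemma tensor2_delta s t : tensor2 (delta_mx s t) = gen k s * gen k t.
Proof. exact: sum_delta. Qed.

Definition comm_form s t : 'M[k]_4 := delta_mx s t - delta_mx t s.
Definition anticomm_form s t : 'M[k]_4 := delta_mx s t + delta_mx t s.

Lemma tensor2_comm s t :
  tensor2 (comm_form s t) = commutator (gen k s) (gen k t).
Proof. by rewrite linearB /= !tensor2_delta. Qed.

Lemma tensor2_anticomm s t :
  tensor2 (anticomm_form s t) = anticommutator (gen k s) (gen k t).
Proof. by rewrite linearD /= !tensor2_delta. Qed.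

Lemma tensor2_comm_rel d j s t :
  tensor2 (comm_form i0 j - d *: anticomm_form s t) =
  commutator (gen k i0) (gen k j) - d *: anticommutator (gen k s) (gen k t).
Proof. by rewrite linearB linearZ /= tensor2_comm tensor2_anticomm. Qed.

Lemma tensor2_anticomm_rel j s t :
  tensor2 (anticomm_form i0 j - comm_form s t) =
  anticommutator (gen k i0) (gen k j) - commutator (gen k s) (gen k t).
Proof. by rewrite linearB /= tensor2_comm tensor2_anticomm. Qed.

Definition rel_forms alpha beta gamma : seq 'M[k]_4 :=
  [:: comm_form i0 i1 - alpha *: anticomm_form i2 i3;
      comm_form i0 i2 - beta *: anticomm_form i3 i1;
      comm_form i0 i3 - gamma *: anticomm_form i1 i2;
      anticomm_form i0 i1 - comm_form i2 i3;
      anticomm_form i0 i2 - comm_form i3 i1;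
      anticomm_form i0 i3 - comm_form i1 i2].

Lemma relAE alpha beta gamma f :
  relA alpha beta gamma f <->
  exists2 M, M \in rel_forms alpha beta gamma & f = tensor2 M.
Proof.
rewrite /relA; set s := (X in f \in X).
have -> : s = [seq tensor2 M | M <- rel_forms alpha beta gamma].
  by rewrite /= !tensor2_comm_rel !tensor2_anticomm_rel.
by split=> [/mapP // | [M Ms ->]]; apply: map_f.
Qed.

Lemma comm_relE d j s t p q :
  (comm_form i0 j - d *: anticomm_form s t) p q =
    ((p == i0) && (q == j))%:R - ((p == j) && (q == i0))%:R
    - d * (((p == s) && (q == t))%:R + ((p == t) && (q == s))%:R).
Proof. by rewrite !mxE. Qed.

Lemma anticomm_relE j s t p q :
  (anticomm_form i0 j - comm_form s t) p q =
    ((p == i0) && (q == j))%:R + ((p == j) && (q == i0))%:R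
    - (((p == s) && (q == t))%:R - ((p == t) && (q == s))%:R).
Proof. by rewrite !mxE. Qed.

(** On the span of the relations [M i0 j - M j i0] is twice the coefficient of
    the [j]-th commutator relation, and [M s t + M t s] is [- e] times as much
    ([e] being its parameter); the defect measures the failure of this
    proportionality.  Likewise [anti_defect] compares [M i0 j + M j i0] with
    [M s t - M t s], which are opposite on the span. *)
Definition comm_defect e M j s t := e * (M i0 j - M j i0) + (M s t + M t s).
Definition anti_defect M j s t := M i0 j + M j i0 + (M s t - M t s).

Definition rel_defects alpha beta gamma M :=
  [:: M i0 i0; M i1 i1; M i2 i2; M i3 i3;
      comm_defect alpha M i1 i2 i3; comm_defect beta M i2 i3 i1;
      comm_defect gamma M i3 i1 i2;
      anti_defect M i1 i2 i3; anti_defect M i2 i3 i1; anti_defect M i3 i1 i2].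

Definition no_defect alpha beta gamma M :=
  all (fun x => x == 0) (rel_defects alpha beta gamma M).

Lemma rel_forms_no_defect alpha beta gamma :
  all (no_defect alpha beta gamma) (rel_forms alpha beta gamma).
Proof.
rewrite /= andbT; apply/and5P; split; last (apply/andP; split).
all: rewrite /no_defect /= /comm_defect /anti_defect.
1-3: rewrite !comm_relE.
4-6: rewrite !anticomm_relE.
all: rewrite !eqxx; move: inord4E; move: i0 i1 i2 i3 => j0 j1 j2 j3 neq.
all: by rewrite !neq /=; do !(apply/andP; split) => //; apply/eqP; ring.
Qed.

Lemma solve_defects (u v x y : k) : 2%:R != 0 :> k ->
  u + (x + y) = 0 -> v + (x - y) = 0 ->
  x = - (u + v) / 2%:R /\ y = (v - u) / 2%:R.
Proof.
move=> n2 xy_u xy_v; split.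
  have <- : x - 2%:R^-1 * (u + (x + y)) - 2%:R^-1 * (v + (x - y)) = x.
    by rewrite xy_u xy_v; ring.
  by field.
have <- : y - 2%:R^-1 * (u + (x + y)) + 2%:R^-1 * (v + (x - y)) = y.
  by rewrite xy_u xy_v; ring.
by field.
Qed.

(** The coefficients of the combination can be read off from row and column
    [0] of [M]; the defects being zero, [solve_defects] recovers the remaining
    entries from these. *)
Lemma no_defect_span alpha beta gamma M : 2%:R != 0 :> k ->
  no_defect alpha beta gamma M ->
  exists x : 'I_6 -> k,
    M = \sum_(n < 6) x n *: (rel_forms alpha beta gamma)`_n.
Proof.
move=> n2.
rewrite /no_defect /= andbT => /and5P[/eqP M0 /eqP M1 /eqP M2 /eqP M3].
case/and5P=> /eqP C1 /eqP C2 /eqP C3 /eqP A1 /andP[/eqP A2 /eqP A3].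
have [M23 M32] := solve_defects n2 C1 A1.
have [M31 M13] := solve_defects n2 C2 A2.
have [M12 M21] := solve_defects n2 C3 A3.
exists (fun n => [:: (M i0 i1 - M i1 i0) / 2%:R; (M i0 i2 - M i2 i0) / 2%:R;
  (M i0 i3 - M i3 i0) / 2%:R; (M i0 i1 + M i1 i0) / 2%:R;
  (M i0 i2 + M i2 i0) / 2%:R; (M i0 i3 + M i3 i0) / 2%:R]`_n).
apply/matrixP=> p q; rewrite summxE.
under eq_bigr do rewrite mxE.
rewrite !big_ord_recl big_ord0 addr0 /=.
rewrite !comm_relE !anticomm_relE.
(* Abstracting the indices keeps the rewriting of entries syntactic. *)
move: inord4E M0 M1 M2 M3 M23 M32 M31 M13 M12 M21 => neq {C1 C2 C3 A1 A2 A3}.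
move: p q; apply: ord4P; apply: ord4P.
all: move: neq; move: i0 i1 i2 i3 => j0 j1 j2 j3 neq
  M0 M1 M2 M3 M23 M32 M31 M13 M12 M21.
all: rewrite !neq ?eqxx /= ?M0 ?M1 ?M2 ?M3 ?M23 ?M32 ?M31 ?M13 ?M12 ?M21.
all: by field.
Qed.

End RelationForms.

(** * Points and the twist *)

Lemma bool_iff (x y : bool) : x = y -> x <-> y.
Proof. by move=> ->. Qed.

Section Points.
Variable k : fieldType.
Implicit Types (p q : P3 k) (u v w : 'rV[k]_4) (M : 'M[k]_4).

Lemma vec4E (v0 v1 v2 v3 : k) :
  (vec4 v0 v1 v2 v3 0 i0 = v0) * (vec4 v0 v1 v2 v3 0 i1 = v1) *
  (vec4 v0 v1 v2 v3 0 i2 = v2) * (vec4 v0 v1 v2 v3 0 i3 = v3).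
Proof. by do !split; rewrite mxE inordK. Qed.

Lemma vec4_eq0 (v0 v1 v2 v3 : k) :
  (vec4 v0 v1 v2 v3 == 0) = [&& v0 == 0, v1 == 0, v2 == 0 & v3 == 0].
Proof.
apply/eqP/and4P => [v0E | [/eqP-> /eqP-> /eqP-> /eqP->]].
  have := vec4E v0 v1 v2 v3; rewrite v0E !mxE.
  by case=> [[[<- <-] <-] <-].
by apply/rowP; apply: ord4P; rewrite vec4E mxE.
Qed.

Lemma flipv0E (v0 v1 v2 v3 : k) :
  flipv [:: 0%N] (vec4 v0 v1 v2 v3) = vec4 (- v0) v1 v2 v3.
Proof. by apply/rowP; apply: ord4P; rewrite [LHS]mxE !vec4E inordK. Qed.

Lemma flipv23E (v0 v1 v2 v3 : k) :
  flipv [:: 2%N; 3%N] (vec4 v0 v1 v2 v3) = vec4 v0 v1 (- v2) (- v3).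
Proof. by apply/rowP; apply: ord4P; rewrite [LHS]mxE !vec4E inordK. Qed.

Lemma flipv13E (v0 v1 v2 v3 : k) :
  flipv [:: 1%N; 3%N] (vec4 v0 v1 v2 v3) = vec4 v0 (- v1) v2 (- v3).
Proof. by apply/rowP; apply: ord4P; rewrite [LHS]mxE !vec4E inordK. Qed.

Lemma flipv12E (v0 v1 v2 v3 : k) :
  flipv [:: 1%N; 2%N] (vec4 v0 v1 v2 v3) = vec4 v0 (- v1) (- v2) v3.
Proof. by apply/rowP; apply: ord4P; rewrite [LHS]mxE !vec4E inordK. Qed.

Lemma line_flip s p v : line p = <[v]>%VS -> line (flip s p) = <[flipv s v]>%VS.
Proof. by move=> /= ->; rewrite limg_line lfunE. Qed.

Lemma points_common s t p : points s p -> points t p ->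
  exists v w l, [/\ v \in s, w \in t & w = l *: v].
Proof.
move=> /mapP[v vs pv] /mapP[w wt pw].
have /vlineP[l wE] : w \in <[v]>%VS by rewrite -pv pw memv_line.
by exists v, w, l.
Qed.

Definition bil M v w : k := (v *m M *m w^T) 0 0.

(** The terms are grouped as in the defects: the diagonal, then one group of
    four entries for each cyclic permutation of [(1, 2, 3)]. *)
Lemma bil_vec4 M (p0 p1 p2 p3 q0 q1 q2 q3 : k) :
  bil M (vec4 p0 p1 p2 p3) (vec4 q0 q1 q2 q3) =
    p0 * q0 * M i0 i0 + p1 * q1 * M i1 i1
    + p2 * q2 * M i2 i2 + p3 * q3 * M i3 i3
    + (p0 * q1 * M i0 i1 + p1 * q0 * M i1 i0
       + p2 * q3 * M i2 i3 + p3 * q2 * M i3 i2)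
    + (p0 * q2 * M i0 i2 + p2 * q0 * M i2 i0
       + p3 * q1 * M i3 i1 + p1 * q3 * M i1 i3)
    + (p0 * q3 * M i0 i3 + p3 * q0 * M i3 i0
       + p1 * q2 * M i1 i2 + p2 * q1 * M i2 i1).
Proof.
rewrite /bil mxE.
under eq_bigr => t _ do rewrite mxE [_^T _ _]mxE sum4E.
by rewrite sum4E !vec4E; ring.
Qed.

Lemma form_vanishes_line M p q v w :
  line p = <[v]>%VS -> line q = <[w]>%VS ->
  form_vanishes M p q <-> bil M v w = 0.
Proof.
move=> pv qw; split=> [Mpq | Mvw u u'].
  by rewrite /bil Mpq ?mxE // (pv, qw) memv_line.
rewrite pv qw => /vlineP[l ->] /vlineP[m ->].
rewrite linearZ /= -!scalemxAl -scalemxAr.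
by rewrite [_ *m _ *m _]mx11_scalar -/(bil M v w) Mvw raddf0 !scaler0.
Qed.

(** A point is a line, and bilinearity reduces the vanishing on a pair of lines
    to one pair of spanning vectors; [sigma] lifts the map [F] of projective
    space to these vectors. *)
Lemma vanish_points s (F : P3 k -> P3 k) (sigma : 'rV[k]_4 -> 'rV[k]_4) M :
  0 \notin s ->
  (forall p v, points s p -> line p = <[v]>%VS ->
     line (F p) = <[sigma v]>%VS) ->
  (forall p, points s p -> form_vanishes M p (F p)) <->
  all (fun v => bil M v (sigma v) == 0) s.
Proof.
move=> s0 FE; split=> [MF | /allP Ms p ps].
  apply/allP=> v vs; have v0 : v != 0 by apply: contraNneq s0 => <-.
  have dimv : \dim <[v]>%VS == 1%N by rewrite dim_vline v0.
  pose p := Point dimv; have ps : points s p by apply: map_f.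
  have pv : line p = <[v]>%VS by [].
  exact/eqP/(form_vanishes_line M pv (FE p v ps pv))/MF.
have /mapP[v vs pv] := ps.
by apply/(form_vanishes_line _ pv (FE p v ps pv))/eqP/Ms.
Qed.

(** The three sign patterns are the nontrivial characters of the Klein
    four-group, which are linearly independent when 2 is invertible. *)
Lemma klein_sums (x y z : k) : 2%:R != 0 :> k ->
  [&& x + y + z == 0, x - y - z == 0, - x + y - z == 0 & - x - y + z == 0] =
  [&& x == 0, y == 0 & z == 0].
Proof.
move=> n2; apply/and4P/and3P; last first.
  by case=> /eqP-> /eqP-> /eqP->; rewrite !(oppr0, addr0).
have halve (t : k) : 2%:R * t = 0 -> t == 0.
  by move/eqP; rewrite mulf_eq0 (negPf n2).
case=> /eqP h0 /eqP h1 /eqP h2 _; split; apply: halve.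
- have -> : 2%:R * x = (x + y + z) + (x - y - z) by ring.
  by rewrite h0 h1 addr0.
- have -> : 2%:R * y = (x + y + z) + (- x + y - z) by ring.
  by rewrite h0 h2 addr0.
have -> : 2%:R * z = - (x - y - z) - (- x + y - z) by ring.
by rewrite h1 h2 oppr0 addr0.
Qed.

Lemma scaled_klein_sums (r s t x y z : k) :
  2%:R != 0 :> k -> r != 0 -> s != 0 -> t != 0 ->
  [&& x == 0, y == 0 & z == 0] =
  [&& r * x + s * y + t * z == 0, r * x - s * y - t * z == 0,
      - (r * x) + s * y - t * z == 0 & - (r * x) - s * y + t * z == 0].
Proof.
move=> n2 r0 s0 t0.
by rewrite klein_sums // !mulf_eq0 (negPf r0) (negPf s0) (negPf t0).
Qed.

End Points.

(** * The graph of the twist *)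

Section Graph.
Variables (k : fieldType) (i a b c : k).
Hypotheses (n2 : 2%:R != 0 :> k) (hi : i ^+ 2 = - 1).
Hypotheses (a0 : a != 0) (b0 : b != 0) (c0 : c != 0).
Hypothesis hsum : a ^+ 2 + b ^+ 2 + c ^+ 2 + a ^+ 2 * b ^+ 2 * c ^+ 2 != 0.
Implicit Types (p : P3 k) (v : 'rV[k]_4) (M : 'M[k]_4).

Let i_neq0 : i != 0.
Proof. by rewrite -sqrf_eq0 hi oppr_eq0 oner_neq0. Qed.

(** The vectors behind the five families: [points coords_j] is convertible to
    the [j]-th of them. *)
Let coords_inf : seq 'rV[k]_4 :=
  [:: vec4 1 0 0 0; vec4 0 1 0 0; vec4 0 0 1 0; vec4 0 0 0 1].

Let coords_0 : seq 'rV[k]_4 :=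
  [:: vec4 (a * b * c) a b c;        vec4 (a * b * c) a (- b) (- c);
      vec4 (a * b * c) (- a) b (- c); vec4 (a * b * c) (- a) (- b) c].

Let coords_1 : seq 'rV[k]_4 :=
  [:: vec4 a (- (i * a)) (- i) (- 1); vec4 a (- (i * a)) i 1;
      vec4 a (i * a) (- i) 1;         vec4 a (i * a) i (- 1)].

Let coords_2 : seq 'rV[k]_4 :=
  [:: vec4 b (- 1) (- (i * b)) (- i); vec4 b (- 1) (i * b) i;
      vec4 b 1 (- (i * b)) i;         vec4 b 1 (i * b) (- i)].

Let coords_3 : seq 'rV[k]_4 :=
  [:: vec4 c (- i) (- 1) (- (i * c)); vec4 c (- i) 1 (i * c);
      vec4 c i (- 1) (i * c);         vec4 c i 1 (- (i * c))].

Definition squares v : 'rV[k]_4 := \row_j v 0 j ^+ 2.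

Lemma squares_vec4 (v0 v1 v2 v3 : k) :
  squares (vec4 v0 v1 v2 v3) = vec4 (v0 ^+ 2) (v1 ^+ 2) (v2 ^+ 2) (v3 ^+ 2).
Proof. by apply/rowP; apply: ord4P; rewrite mxE !vec4E. Qed.

Lemma squares_0 : {in coords_0, forall v, squares v =
  vec4 (a ^+ 2 * b ^+ 2 * c ^+ 2) (a ^+ 2) (b ^+ 2) (c ^+ 2)}.
Proof.
move=> v; rewrite !inE.
by case/or4P=> /eqP->; rewrite squares_vec4; congr vec4; ring.
Qed.

Lemma squares_1 : {in coords_1, forall v, squares v =
  vec4 (a ^+ 2) (- a ^+ 2) (- 1) 1}.
Proof.
move=> v; rewrite !inE.
by case/or4P=> /eqP->; rewrite squares_vec4; congr vec4; ring: hi.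
Qed.

Lemma squares_2 : {in coords_2, forall v, squares v =
  vec4 (b ^+ 2) 1 (- b ^+ 2) (- 1)}.
Proof.
move=> v; rewrite !inE.
by case/or4P=> /eqP->; rewrite squares_vec4; congr vec4; ring: hi.
Qed.

Lemma squares_3 : {in coords_3, forall v, squares v =
  vec4 (c ^+ 2) (- 1) 1 (- c ^+ 2)}.
Proof.
move=> v; rewrite !inE.
by case/or4P=> /eqP->; rewrite squares_vec4; congr vec4; ring: hi.
Qed.

(** A projective point lying in two families on which the squares of the
    coordinates are constant makes the two vectors of squares proportional. *)
Lemma squares_common s t p (x0 x1 x2 x3 y0 y1 y2 y3 : k) :
  {in s, forall v, squares v = vec4 x0 x1 x2 x3} ->
  {in t, forall v, squares v = vec4 y0 y1 y2 y3} ->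
  points s p -> points t p ->
  exists m, [/\ y0 = m * x0, y1 = m * x1, y2 = m * x2 & y3 = m * x3].
Proof.
move=> sx ty ps pt; have [v [w [l [vs wt wE]]]] := points_common ps pt.
have xE := sx v vs; have yE := ty w wt.
have sqE j : squares w 0 j = l ^+ 2 * squares v 0 j.
  by rewrite wE !mxE exprMn.
exists (l ^+ 2).
by move: (sqE i0) (sqE i1) (sqE i2) (sqE i3); rewrite xE yE !vec4E.
Qed.

(** Every coordinate point satisfies [v_0 v_1 = 0], an equation that no vector
    of the other families satisfies. *)
Lemma disjoint_inf p : P_0 a b c p || P_1 i a p || P_2 i b p || P_3 i c p ->
  Pinf p = false.
Proof.
move=> pfin; apply/negP=> pinf.
have [s] : exists2 s, points s p & {in s, forall v, v 0 i0 * v 0 i1 != 0}.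
  case/orP: pfin => [/orP[/orP[]|]|] ps.
  - exists coords_0 => // v; rewrite !inE.
    by case/or4P=> /eqP->; rewrite !vec4E ?mulf_neq0 ?oppr_eq0.
  - exists coords_1 => // v; rewrite !inE.
    by case/or4P=> /eqP->; rewrite !vec4E ?(mulf_neq0, oppr_eq0).
  - exists coords_2 => // v; rewrite !inE.
    by case/or4P=> /eqP->; rewrite !vec4E ?(mulf_neq0, oppr_eq0, oner_neq0).
  exists coords_3 => // v; rewrite !inE.
  by case/or4P=> /eqP->; rewrite !vec4E ?(mulf_neq0, oppr_eq0).
move=> ps sN0.
have [v [w [l [vs wt wE]]]] := points_common (s := coords_inf) pinf ps.
move: (sN0 w wt); rewrite wE !mxE; move: vs; rewrite !inE.
by case/or4P=> /eqP->; rewrite !vec4E ?(mulr0, mul0r) eqxx.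
Qed.

Let a2 : a ^+ 2 != 0. Proof. by rewrite expf_neq0. Qed.
Let b2 : b ^+ 2 != 0. Proof. by rewrite expf_neq0. Qed.
Let c2 : c ^+ 2 != 0. Proof. by rewrite expf_neq0. Qed.

Let sum0 : a ^+ 2 + b ^+ 2 + c ^+ 2 + a ^+ 2 * b ^+ 2 * c ^+ 2 = 0 -> False.
Proof. by apply/eqP. Qed.

(** In each case the ratio [m] of the vectors of squares is [- 1] and two of
    [a ^+ 2], [b ^+ 2], [c ^+ 2] are [1] and [- 1], which makes the sum in
    [hsum] vanish whatever the third one is. *)
Lemma disjoint_0 p : P_1 i a p || P_2 i b p || P_3 i c p -> P_0 a b c p = false.
Proof.
move=> pfin; apply/negP=> p0; apply: sum0.
case/orP: pfin => [/orP[]|] ps.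
- have [m [_ E1 E2 E3]] := squares_common squares_0 squares_1 p0 ps.
  have m1 : m = - 1 by apply: (mulIf a2); rewrite -E1 mulN1r.
  have bb : b ^+ 2 = 1 by apply: oppr_inj; rewrite E2 m1 mulN1r.
  have cc : c ^+ 2 = - 1 by apply: oppr_inj; rewrite opprK E3 m1 mulN1r.
  by rewrite bb cc; ring.
- have [m [_ E1 E2 E3]] := squares_common squares_0 squares_2 p0 ps.
  have m1 : m = - 1 by apply: (mulIf b2); rewrite -E2 mulN1r.
  have aa : a ^+ 2 = - 1 by apply: oppr_inj; rewrite opprK E1 m1 mulN1r.
  have cc : c ^+ 2 = 1 by apply: oppr_inj; rewrite E3 m1 mulN1r.
  by rewrite aa cc; ring.
have [m [_ E1 E2 E3]] := squares_common squares_0 squares_3 p0 ps.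
have m1 : m = - 1 by apply: (mulIf c2); rewrite -E3 mulN1r.
have aa : a ^+ 2 = 1 by apply: oppr_inj; rewrite E1 m1 mulN1r.
have bb : b ^+ 2 = - 1 by apply: oppr_inj; rewrite opprK E2 m1 mulN1r.
by rewrite aa bb; ring.
Qed.

Lemma disjoint_1 p : P_2 i b p || P_3 i c p -> P_1 i a p = false.
Proof.
move=> pfin; apply/negP=> p1; apply: sum0.
case/orP: pfin => ps.
- have [m [E0 E1 _ E3]] := squares_common squares_1 squares_2 p1 ps.
  have m1 : m = - 1 by rewrite E3 mulr1.
  have aa : a ^+ 2 = 1 by rewrite E1 m1 mulrNN mul1r.
  have bb : b ^+ 2 = - 1 by rewrite E0 m1 aa mulr1.
  by rewrite aa bb; ring.
have [m [E0 E1 E2 _]] := squares_common squares_1 squares_3 p1 ps.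
have m1 : m = - 1 by rewrite E2 mulrN1 opprK.
have aa : a ^+ 2 = - 1 by rewrite E1 m1 mulrNN mul1r.
have cc : c ^+ 2 = 1 by rewrite E0 m1 aa mulrNN mul1r.
by rewrite aa cc; ring.
Qed.

Lemma disjoint_2 p : P_3 i c p -> P_2 i b p = false.
Proof.
move=> ps; apply/negP=> p2; apply: sum0.
have [m [E0 E1 E2 _]] := squares_common squares_2 squares_3 p2 ps.
have m1 : m = - 1 by rewrite E1 mulr1.
have bb : b ^+ 2 = 1 by rewrite E2 m1 mulrNN mul1r.
have cc : c ^+ 2 = - 1 by rewrite E0 m1 bb mulr1.
by rewrite bb cc; ring.
Qed.

Local Notation theta := (theta i a b c).

Lemma theta_inf p : Pinf p -> theta p = p.
Proof. by rewrite /theta => ->. Qed.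

Lemma theta_0 p : P_0 a b c p -> theta p = ominus p.
Proof. by move=> ps; rewrite /theta disjoint_inf ?ps. Qed.

Lemma theta_1 p : P_1 i a p -> theta p = ominus (gamma1 p).
Proof. by move=> ps; rewrite /theta disjoint_inf ?disjoint_0 ?ps ?orbT. Qed.

Lemma theta_2 p : P_2 i b p -> theta p = ominus (gamma2 p).
Proof.
by move=> ps; rewrite /theta disjoint_inf ?disjoint_0 ?disjoint_1 ?ps ?orbT.
Qed.

Lemma theta_3 p : P_3 i c p -> theta p = ominus (gamma3 p).
Proof.
move=> ps; rewrite /theta disjoint_inf ?disjoint_0 ?disjoint_1 ?ps ?orbT //.
by rewrite disjoint_2.
Qed.

Definition vanishes_on (P : pred (P3 k)) M :=
  forall p, P p -> form_vanishes M p (theta p).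

Lemma vanishes_on_inf M :
  vanishes_on (@Pinf k) M <->
  [&& M i0 i0 == 0, M i1 i1 == 0, M i2 i2 == 0 & M i3 i3 == 0].
Proof.
rewrite /vanishes_on (@vanish_points k coords_inf theta id).
- rewrite /= !bil_vec4 andbT.
  by rewrite !(mul0r, mulr0, add0r, addr0, mul1r).
- by rewrite !inE !(eq_sym 0) !vec4_eq0 !oner_eq0 !eqxx.
by move=> p v pinf; rewrite theta_inf.
Qed.

(** The sign changes of [(a, b, c)] multiply the [j]-th group of four entries
    of [M] by the [j]-th character, while theta negates the coordinate [0]
    alone, which turns each group into a commutator defect. *)
Lemma vanishes_on_0 M :
  [&& M i0 i0 == 0, M i1 i1 == 0, M i2 i2 == 0 & M i3 i3 == 0] ->
  vanishes_on (P_0 a b c) M <->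
  [&& comm_defect (a ^+ 2) M i1 i2 i3 == 0,
      comm_defect (b ^+ 2) M i2 i3 i1 == 0 &
      comm_defect (c ^+ 2) M i3 i1 i2 == 0].
Proof.
case/and4P=> /eqP M0 /eqP M1 /eqP M2 /eqP M3.
rewrite /vanishes_on (@vanish_points k coords_0 theta (flipv [:: 0%N])).
- rewrite (@scaled_klein_sums _ (b * c) (a * c) (a * b)) //;
    rewrite ?mulf_neq0 ?oppr_eq0 //.
  rewrite /= !flipv0E !bil_vec4 M0 M1 M2 M3 andbT.
  rewrite /comm_defect /anti_defect.
  by apply: bool_iff; do !congr (_ && _); congr (_ == _); ring: hi.
- by rewrite !inE !(eq_sym 0) !vec4_eq0 !mulf_eq0
    ?(negPf a0, negPf b0, negPf c0).
by move=> p v ps pv; rewrite theta_0 //; apply: line_flip.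
Qed.

(** Composing the negation of the coordinate [0] with [gamma1] leaves a
    commutator defect for [j = 1] and produces anticommutator defects for
    [j = 2] and [j = 3].  The next two lemmas are its cyclic translates. *)
Lemma vanishes_on_1 M :
  [&& M i0 i0 == 0, M i1 i1 == 0, M i2 i2 == 0 & M i3 i3 == 0] ->
  vanishes_on (P_1 i a) M <->
  [&& comm_defect (a ^+ 2) M i1 i2 i3 == 0,
      anti_defect M i2 i3 i1 == 0 &
      anti_defect M i3 i1 i2 == 0].
Proof.
case/and4P=> /eqP M0 /eqP M1 /eqP M2 /eqP M3.
rewrite /vanishes_on (@vanish_points k coords_1 theta
  (fun v => flipv [:: 0%N] (flipv [:: 2%N; 3%N] v))).
- rewrite (@scaled_klein_sums _ (- i) (i * a) a) //;
    rewrite ?mulf_neq0 ?oppr_eq0 //.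
  rewrite /= !flipv23E !flipv0E !bil_vec4 M0 M1 M2 M3 andbT.
  rewrite /comm_defect /anti_defect.
  by apply: bool_iff; do !congr (_ && _); congr (_ == _); ring: hi.
- by rewrite !inE !(eq_sym 0) !vec4_eq0 !mulf_eq0
    ?(negPf a0, negPf b0, negPf c0).
by move=> p v ps pv; rewrite theta_1 //; do 2!apply: line_flip.
Qed.

Lemma vanishes_on_2 M :
  [&& M i0 i0 == 0, M i1 i1 == 0, M i2 i2 == 0 & M i3 i3 == 0] ->
  vanishes_on (P_2 i b) M <->
  [&& anti_defect M i1 i2 i3 == 0,
      comm_defect (b ^+ 2) M i2 i3 i1 == 0 &
      anti_defect M i3 i1 i2 == 0].
Proof.
case/and4P=> /eqP M0 /eqP M1 /eqP M2 /eqP M3.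
rewrite /vanishes_on (@vanish_points k coords_2 theta
  (fun v => flipv [:: 0%N] (flipv [:: 1%N; 3%N] v))).
- rewrite (@scaled_klein_sums _ b (- i) (i * b)) //;
    rewrite ?mulf_neq0 ?oppr_eq0 //.
  rewrite /= !flipv13E !flipv0E !bil_vec4 M0 M1 M2 M3 andbT.
  rewrite /comm_defect /anti_defect.
  by apply: bool_iff; do !congr (_ && _); congr (_ == _); ring: hi.
- by rewrite !inE !(eq_sym 0) !vec4_eq0 !mulf_eq0
    ?(negPf a0, negPf b0, negPf c0).
by move=> p v ps pv; rewrite theta_2 //; do 2!apply: line_flip.
Qed.

Lemma vanishes_on_3 M :
  [&& M i0 i0 == 0, M i1 i1 == 0, M i2 i2 == 0 & M i3 i3 == 0] ->
  vanishes_on (P_3 i c) M <->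
  [&& anti_defect M i1 i2 i3 == 0,
      anti_defect M i2 i3 i1 == 0 &
      comm_defect (c ^+ 2) M i3 i1 i2 == 0].
Proof.
case/and4P=> /eqP M0 /eqP M1 /eqP M2 /eqP M3.
rewrite /vanishes_on (@vanish_points k coords_3 theta
  (fun v => flipv [:: 0%N] (flipv [:: 1%N; 2%N] v))).
- rewrite (@scaled_klein_sums _ (i * c) c (- i)) //;
    rewrite ?mulf_neq0 ?oppr_eq0 //.
  rewrite /= !flipv12E !flipv0E !bil_vec4 M0 M1 M2 M3 andbT.
  rewrite /comm_defect /anti_defect.
  by apply: bool_iff; do !congr (_ && _); congr (_ == _); ring: hi.
- by rewrite !inE !(eq_sym 0) !vec4_eq0 !mulf_eq0
    ?(negPf a0, negPf b0, negPf c0).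
by move=> p v ps pv; rewrite theta_3 //; do 2!apply: line_flip.
Qed.

Lemma vanishes_on_PP M :
  vanishes_on (PP i a b c) M <-> no_defect (a ^+ 2) (b ^+ 2) (c ^+ 2) M.
Proof.
rewrite /no_defect /=; split=> [MP | ].
  have /vanishes_on_inf M_inf : vanishes_on (@Pinf k) M.
    by move=> p ps; apply: MP; rewrite /PP /= ps.
  have /(vanishes_on_0 M_inf)/and3P[-> -> ->] : vanishes_on (P_0 a b c) M.
    by move=> p ps; apply: MP; rewrite /PP /= ps !orbT.
  have /(vanishes_on_1 M_inf)/and3P[_ -> ->] : vanishes_on (P_1 i a) M.
    by move=> p ps; apply: MP; rewrite /PP /= ps !orbT.
  have /(vanishes_on_2 M_inf)/and3P[-> _ _] : vanishes_on (P_2 i b) M.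
    by move=> p ps; apply: MP; rewrite /PP /= ps !orbT.
  by case/and4P: M_inf => -> -> -> ->.
case/and5P=> M0 M1 M2 M3 /and5P[C1 C2 C3 A1 /and3P[A2 A3 _]].
have M_inf : [&& M i0 i0 == 0, M i1 i1 == 0, M i2 i2 == 0 & M i3 i3 == 0].
  by rewrite M0 M1 M2 M3.
have V_inf : vanishes_on (@Pinf k) M by apply/vanishes_on_inf.
have V_0 : vanishes_on (P_0 a b c) M.
  by apply/(vanishes_on_0 M_inf); rewrite C1 C2 C3.
have V_1 : vanishes_on (P_1 i a) M.
  by apply/(vanishes_on_1 M_inf); rewrite C1 A2 A3.
have V_2 : vanishes_on (P_2 i b) M.
  by apply/(vanishes_on_2 M_inf); rewrite C2 A1 A3.
have V_3 : vanishes_on (P_3 i c) M.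
  by apply/(vanishes_on_3 M_inf); rewrite C3 A1 A2.
by move=> p /or4P[/V_inf | /V_0 | /V_1 | /orP[/V_2 | /V_3]].
Qed.

End Graph.

(** * The isomorphism *)

Theorem corollary3p5 (k : fieldType) (hchar : 2%N \notin [pchar k])
  (i a b c alpha beta gamma : k)
  (hi : i ^+ 2 = - 1)
  (ha : a ^+ 2 = alpha) (hb : b ^+ 2 = beta) (hc : c ^+ 2 = gamma)
  (hprod : alpha * beta * gamma != 0)
  (hsum : alpha + beta + gamma + alpha * beta * gamma != 0) :
  exists f : {rmorphism algA alpha beta gamma -> algR i a b c},
    scalable f /\ bijective f.
Proof.
subst alpha beta gamma.
have n2 : 2%:R != 0 :> k by move: hchar; rewrite inE.
move: hprod; rewrite -!exprMn sqrf_eq0 !mulf_eq0 !negb_or.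
move=> /andP[/andP[a0 b0] c0].
have graphP := vanishes_on_PP n2 hi a0 b0 c0 hsum.
apply: quot_alg_iso => f.
  case/relAE=> M Ms ->; apply: ideal_gen_incl; exists M => //.
  by apply/graphP/(allP (rel_forms_no_defect _ _ _)).
case=> M -> /graphP /(no_defect_span n2)[x ->].
rewrite linear_sum; apply/ideal_memP/rpred_sum => n _.
rewrite linearZ /= -mulr_algl; apply/ideal_memMl/ideal_memP/ideal_gen_incl.
apply/relAE; exists (rel_forms (a ^+ 2) (b ^+ 2) (c ^+ 2))`_n => //.
exact: mem_nth.
Qed.
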